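(* Let $k\in\mathbb{N}$. The iterated umbral Dirac operator $(D')^k$ has the mapping property $$(D')^k:(x')^s\ker D'\to(x')^{s-k}\ker D'$$ for any $s\ge k$. Here, for each $f(\underline{x})\in\ker D'$, $$(D')^k\left((x')^sf(\underline{x})\right)=(-2)^k(x')^{s-k}U_{s-k+1}'\cdots U_{s-1}'U_s'f(\underline{x}),$$ where, for $j\in\mathbb{N}$, $U_j'=m\,\mathbf{id}$ if $j=2m$ and $U_j'=E'+\left(\frac n2+m\right)\mathbf{id}$ if $j=2m+1$.
   Context: Let $n\ge 1$ and let $\mathbb{R}[\underline{x}]$ be the ring of real polynomials in $\underline{x}=(x_1,\ldots,x_n)$. A linear operator on $\mathbb{R}[\underline{x}]$ is shift-invariant if it commutes with all translations $f(\underline{x})\mapsto f(\underline{x}+\underline{y})$. A multivariate delta operator is a tuple $(O_{x_1},\ldots,O_{x_n})$ of shift-invariant linear operators on $\mathbb{R}[\underline{x}]$ for which there is a constant $c\ne0$ with $O_{x_j}(x_k)=c\,\delta_{jk}$ for all $j,k$. Fix such a tuple, together with linear operators $x_1',\ldots,x_n'$ on $\mathbb{R}[\underline{x}]$ satisfying the Weyl--Heisenberg relations $[O_{x_j},O_{x_k}]=0=[x_j',x_k']$, $[O_{x_j},x_k']=\delta_{jk}\mathbf{id}$, where $[a,b]=ab-ba$. Let $C\ell_{0,n}$ be the real Clifford algebra generated by $\mathbf{e}_1,\ldots,\mathbf{e}_n$ with $\mathbf{e}_j\mathbf{e}_k+\mathbf{e}_k\mathbf{e}_j=-2\delta_{jk}$,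 and $\mathcal{P}=\mathbb{R}[\underline{x}]\otimes C\ell_{0,n}$. The operators $O_{x_j},x_j'$ act on the polynomial factor and $\mathbf{e}_j$ acts by left multiplication. Put $D'=\sum_j\mathbf{e}_jO_{x_j}$ (umbral Dirac operator), $x'=\sum_j\mathbf{e}_jx_j'$, $E'=\sum_jx_j'O_{x_j}$, linear operators on $\mathcal{P}$; $\ker D'$ is the kernel of $D'$ in $\mathcal{P}$. $\mathbb{N}=\{1,2,\ldots\}$. *)

(* Defs.v *)
From HB Require Import structures.
From mathcomp Require Import classical_sets reals.
From mathcomp Require Import all_boot all_order all_algebra.
From mathcomp Require Import mpoly.

Set Implicit Arguments.
Unset Strict Implicit.
Unset Printing Implicit Defensive.

Import Order.TTheory GRing.Theory Num.Theory.
Local Open Scope ring_scope.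

Section IndexSets.
Variable n : nat.
Implicit Types A B C : {set 'I_n}.

Definition symd A B : {set 'I_n} := [set i | (i \in A) (+) (i \in B)].

(* e_A e_B = (-1)^(swaps A B) e_(symd A B), where e_A is the product of the
   e_i (i in A) in increasing order: each pair i > j contributes a sign when
   e_j is moved past e_i, each pair i = j the sign of e_i^2 = -1. *)
Definition swaps A B : nat := \sum_(i in A) #|[set j in B | (j <= i)%N]|.

Lemma symdA A B C : symd A (symd B C) = symd (symd A B) C.
Proof. by apply/setP=> i; rewrite !inE addbA. Qed.

Lemma symdC A B : symd A B = symd B A.
Proof. by apply/setP=> i; rewrite !inE addbC. Qed.

Lemma symd0 A : symd A set0 = A.
Proof. by apply/setP=> i; rewrite !inE addbF. Qed.

Lemma sym0d A : symd set0 A = A.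
Proof. by rewrite symdC symd0. Qed.

Lemma symdK A B : symd A (symd A B) = B.
Proof. by apply/setP=> i; rewrite !inE addKb. Qed.

Lemma symd_eq A B C : (symd A B == C) = (B == symd A C).
Proof. by apply/eqP/eqP=> [<-|->]; rewrite symdK. Qed.

Lemma swapsE A B :
  swaps A B = (\sum_i \sum_j ((i \in A) && (j \in B) && (j <= i)))%N.
Proof.
rewrite /swaps big_mkcond /=; apply: eq_bigr => i _.
case: (i \in A) => /=; last by rewrite big1.
rewrite -sum1_card big_mkcond /=; apply: eq_bigr => j _.
by rewrite inE; case: (_ && _).
Qed.

Lemma odd_swapsDl A B C :
  odd (swaps (symd A B) C) = odd (swaps A C) (+) odd (swaps B C).
Proof.
rewrite !swapsE -oddD -big_split !(big_morph odd oddD (erefl _)) /=.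
apply: eq_bigr => i _; rewrite -big_split !(big_morph odd oddD (erefl _)) /=.
apply: eq_bigr => j _; rewrite inE oddD.
by do 3!case: (_ \in _); case: (_ <= _)%N.
Qed.

Lemma odd_swapsDr A B C :
  odd (swaps A (symd B C)) = odd (swaps A B) (+) odd (swaps A C).
Proof.
rewrite !swapsE -oddD -big_split !(big_morph odd oddD (erefl _)) /=.
apply: eq_bigr => i _; rewrite -big_split !(big_morph odd oddD (erefl _)) /=.
apply: eq_bigr => j _; rewrite inE oddD.
by do 3!case: (_ \in _); case: (_ <= _)%N.
Qed.

Lemma swaps0 A : swaps A set0 = 0%N.
Proof. by rewrite swapsE big1 // => i _; rewrite big1 // => j; rewrite inE andbF. Qed.

Lemma swap0s A : swaps set0 A = 0%N.
Proof. by rewrite /swaps big_set0. Qed.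

Lemma swaps1 (j k : 'I_n) : swaps [set j] [set k] = (k <= j)%N.
Proof.
rewrite /swaps big_set1; case: (leqP k j) => kj.
  rewrite (_ : [set _ in _ | _] = [set k]) ?cards1 //; apply/setP=> i.
  by rewrite !inE; case: eqP => // ->.
apply/eqP; rewrite cards_eq0; apply/eqP/setP=> i.
by rewrite !inE; case: eqP => // ->; rewrite leqNgt kj.
Qed.

End IndexSets.

(* The Clifford algebra Cl_{0,n} with coefficients in A: an element is the
   family of its coordinates in the basis (e_A), A a subset of {0, ..., n-1}. *)
Definition clifford (A : Type) (n : nat) : Type := {ffun {set 'I_n} -> A}.

HB.instance Definition _ (A : choiceType) n := Choice.on (clifford A n).
HB.instance Definition _ (A : zmodType) n := GRing.Zmodule.on (clifford A n).
HB.instance Definition _ (R : nzRingType) (A : lmodType R) n :=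
  GRing.Lmodule.on (clifford A n).

Section CliffordRing.
Variables (A : comNzRingType) (n : nat).
Implicit Types a b c : clifford A n.

Definition cl_one : clifford A n := [ffun S => (S == set0)%:R].

Definition cl_mul a b : clifford A n :=
  [ffun S => \sum_(T : {set 'I_n}) \sum_(U : {set 'I_n} | symd T U == S)
     (-1) ^+ swaps T U * (a T * b U)].

Lemma cl_mulE a b (S : {set 'I_n}) :
  cl_mul a b S = \sum_T (-1) ^+ swaps T (symd T S) * (a T * b (symd T S)).
Proof.
rewrite ffunE; apply: eq_bigr => T _.
by rewrite (big_pred1 (symd T S)) // => U; rewrite symd_eq.
Qed.

Lemma cl_mulA : associative cl_mul.
Proof.
move=> a b c; apply/ffunP=> S; rewrite !cl_mulE.
under eq_bigr do rewrite cl_mulE !mulr_sumr.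
under [RHS]eq_bigr do rewrite cl_mulE mulr_suml mulr_sumr.
rewrite [RHS]exchange_big /=; apply: eq_bigr => T _.
rewrite (reindex_inj (can_inj (symdK T))) /=; apply: eq_bigr => U _.
have -> : symd (symd T U) (symd T S) = symd U S.
  by apply/setP=> i; rewrite !inE; do 3!case: (_ \in _).
rewrite [a T * _]mulrCA !mulrA -!exprD.
rewrite -[in LHS]signr_odd -[in RHS]signr_odd; congr (_ ^+ _ * _ * _ * _).
rewrite !oddD !odd_swapsDl !odd_swapsDr.
by do 8![case: (odd _)].
Qed.

Lemma cl_mul1 : left_id cl_one cl_mul.
Proof.
move=> a; apply/ffunP=> S; rewrite cl_mulE (bigD1 set0) //= big1 => [|T /negPf].
  by rewrite ffunE eqxx sym0d swap0s !mul1r addr0.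
by rewrite ffunE => ->; rewrite mul0r mulr0.
Qed.

Lemma cl_mulr1 : right_id cl_one cl_mul.
Proof.
move=> a; apply/ffunP=> S; rewrite cl_mulE (bigD1 S) //= big1 => [|T TS].
  have -> : symd S S = set0 by apply/setP=> i; rewrite !inE addbb.
  by rewrite ffunE eqxx swaps0 mul1r mulr1 addr0.
by rewrite ffunE symd_eq symd0 eq_sym (negPf TS) !mulr0.
Qed.

Lemma cl_mulDl : left_distributive cl_mul +%R.
Proof.
move=> a b c; apply/ffunP=> S; rewrite cl_mulE [RHS]ffunE !cl_mulE -big_split.
by apply: eq_bigr => T _; rewrite ffunE mulrDl mulrDr.
Qed.

Lemma cl_mulDr : right_distributive cl_mul +%R.
Proof.
move=> a b c; apply/ffunP=> S; rewrite cl_mulE [RHS]ffunE !cl_mulE -big_split.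
by apply: eq_bigr => T _; rewrite ffunE !mulrDr.
Qed.

Lemma cl_one_neq0 : cl_one != 0.
Proof.
apply/eqP=> /(congr1 (fun a : clifford A n => a set0)) /eqP.
by rewrite !ffunE eqxx oner_eq0.
Qed.

HB.instance Definition _ := GRing.Zmodule_isNzRing.Build (clifford A n)
  cl_mulA cl_mul1 cl_mulr1 cl_mulDl cl_mulDr cl_one_neq0.

Lemma clM_E a b (S : {set 'I_n}) :
  (a * b) S = \sum_T (-1) ^+ swaps T (symd T S) * (a T * b (symd T S)).
Proof. exact: cl_mulE. Qed.

Definition cl_basis (S : {set 'I_n}) : clifford A n := [ffun T => (T == S)%:R].

Definition cl_e (j : 'I_n) : clifford A n := cl_basis [set j].

Lemma cl_basisM (S T : {set 'I_n}) :
  cl_basis S * cl_basis T = (-1) ^+ swaps S T * cl_basis (symd S T).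
Proof.
have signE m (a : clifford A n) U : ((-1) ^+ m * a) U = (-1) ^+ m * a U.
  by rewrite -signr_odd -[in RHS]signr_odd; case: odd; rewrite ?mul1r // !mulN1r ffunE.
apply/ffunP=> U; rewrite signE cl_mulE (bigD1 S) //= big1 => [|V /negPf VS].
  rewrite !ffunE eqxx mul1r addr0 -symd_eq.
  by case: eqP => [<-//|]; rewrite !mulr0.
by rewrite ffunE VS mul0r mulr0.
Qed.

Lemma cl_eC (j k : 'I_n) :
  cl_e j * cl_e k + cl_e k * cl_e j = - (2 *+ (j == k)).
Proof.
rewrite !cl_basisM !swaps1 (symdC [set k]).
have [<-|jk] := eqVneq j k.
  have -> : symd [set j] [set j] = set0 by apply/setP=> i; rewrite !inE addbb.
  by rewrite leqnn mulr1n -[cl_basis _]/(1 : clifford A n) mulr1 -opprD.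
rewrite oppr0 -mulrDl leq_eqVlt -[_ == _ :> nat]/(k == j) eq_sym (negPf jk) /=.
by case: ltngtP jk => [jk|jk|/val_inj->]; rewrite ?eqxx //= ?addrN ?addNr ?mul0r.
Qed.

Lemma cl_basis_seq (s : seq 'I_n) :
  sorted (relpre val ltn) s -> \prod_(j <- s) cl_e j = cl_basis [set j in s].
Proof.
elim: s => [|j s IHs] /=; first by rewrite big_nil => _; congr cl_basis; apply/setP=> i; rewrite !inE.
move=> js; rewrite big_cons IHs ?(path_sorted js) // cl_basisM.
have {js} /allP jlt : all (fun i : 'I_n => j < i)%N s.
  by apply: order_path_min js => x y z; apply: ltn_trans.
rewrite [swaps _ _](_ : _ = 0%N) ?mul1r; last first.
  rewrite /swaps big_set1; apply/eqP; rewrite cards_eq0; apply/eqP/setP=> i.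
  by rewrite !inE; apply/andP=> -[/jlt]; rewrite ltnNge => /negP.
congr cl_basis; apply/setP=> i; rewrite !inE.
by case: eqVneq => // ->; case: (boolP (j \in s)) => // /jlt; rewrite ltnn.
Qed.

Lemma cl_basis_prod (S : {set 'I_n}) : cl_basis S = \prod_(j in S) cl_e j.
Proof.
rewrite -big_filter cl_basis_seq; first by congr cl_basis; apply/setP=> i; rewrite inE mem_filter mem_index_enum andbT.
rewrite /index_enum unlock sorted_filter //; first by move=> x y z; apply: ltn_trans.
by rewrite -sorted_map -enumT val_enum_ord iota_ltn_sorted.
Qed.

End CliffordRing.

Section CliffordAlgebra.
Variables (R : nzRingType) (A : comAlgType R) (n : nat).

Lemma cl_scalerAl (c : R) (a b : clifford A n) : c *: (a * b) = (c *: a) * b.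
Proof.
apply/ffunP=> S; rewrite [LHS]ffunE !clM_E scaler_sumr.
by apply: eq_bigr => T _; rewrite ffunE scalerAr scalerAl.
Qed.

HB.instance Definition _ :=
  GRing.Lmodule_isLalgebra.Build R (clifford A n) cl_scalerAl.

Lemma cl_scalerAr (c : R) (a b : clifford A n) : c *: (a * b) = a * (c *: b).
Proof.
apply/ffunP=> S; rewrite [LHS]ffunE !clM_E scaler_sumr.
by apply: eq_bigr => T _; rewrite ffunE !scalerAr.
Qed.

HB.instance Definition _ :=
  GRing.Lalgebra_isAlgebra.Build R (clifford A n) cl_scalerAr.

End CliffordAlgebra.

(* R[x] (x) Cl_{0,n} is realized by extension of scalars, as the Clifford
   algebra with coefficients in R[x]. The pure tensor of p and a is tens p a;
   by tensDl, ..., tens_coord, the space is the free R[x]-module on the basis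
   (e_S) of Cl_{0,n}, i.e. the tensor product. *)
Notation clpoly R n := (clifford {mpoly R[n]} n) (only parsing).
Notation "''Cl0[' R ]_ n" := (clifford R^o n)
  (at level 8, n at level 2, format "''Cl0[' R ]_ n").

Section Tensor.
Variables (R : realType) (n : nat).
Implicit Types (p q : {mpoly R[n]}) (a b : 'Cl0[R]_n) (f g : clpoly R n).

Definition tens p a : clpoly R n := [ffun S => a S *: p].

(* T (x) id *)
Definition lift (T : {mpoly R[n]} -> {mpoly R[n]}) f : clpoly R n :=
  [ffun S => T (f S)].

Lemma tensDl p q a : tens (p + q) a = tens p a + tens q a.
Proof. by apply/ffunP=> S; rewrite !ffunE scalerDr. Qed.

Lemma tensDr p a b : tens p (a + b) = tens p a + tens p b.
Proof. by apply/ffunP=> S; rewrite !ffunE scalerDl. Qed.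

Lemma tensZl (c : R) p a : tens (c *: p) a = c *: tens p a.
Proof. by apply/ffunP=> S; rewrite !ffunE !scalerA mulrC. Qed.

Lemma tensZr (c : R) p a : tens p (c *: a) = c *: tens p a.
Proof. by apply/ffunP=> S; rewrite !ffunE scalerA. Qed.

Lemma tens11 : tens 1 1 = 1.
Proof. by apply/ffunP=> S; rewrite !ffunE; case: eqP; rewrite ?scale1r ?scale0r. Qed.

Lemma tensM p q a b : tens p a * tens q b = tens (p * q) (a * b).
Proof.
apply/ffunP=> S; rewrite clM_E [RHS]ffunE clM_E scaler_suml.
apply: eq_bigr => T _; rewrite [tens p a T]ffunE [tens q b _]ffunE.
have -> (c d : R) : (c *: p) * (d *: q) = (c * d) *: (p * q).
  by rewrite -scalerAl -scalerAr scalerA.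
rewrite -signr_odd -[in RHS]signr_odd; case: odd; rewrite ?expr0 ?mul1r //.
by rewrite expr1 !mulN1r scaleNr.
Qed.

Lemma tens_coord f : f = \sum_S tens (f S) (cl_basis _ S).
Proof.
apply/ffunP=> S; rewrite sum_ffunE (bigD1 S) //= big1 => [|T /negPf TS].
  by rewrite !ffunE eqxx scale1r addr0.
by rewrite !ffunE eq_sym TS scale0r.
Qed.

Lemma lift_tens (T : {linear {mpoly R[n]} -> {mpoly R[n]}}) p a :
  lift T (tens p a) = tens (T p) a.
Proof. by apply/ffunP=> S; rewrite !ffunE linearZ. Qed.

Lemma cl_e_tens j p a : cl_e _ j * tens p a = tens p (cl_e _ j * a).
Proof.
have -> : cl_e _ j = tens 1 (cl_e _ j).
  by apply/ffunP=> S; rewrite !ffunE; case: eqP; rewrite ?scale1r ?scale0r.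
by rewrite tensM mul1r.
Qed.

Lemma lift_linear (T : {linear {mpoly R[n]} -> {mpoly R[n]}}) : linear (lift T).
Proof. by move=> c f g; apply/ffunP=> S; rewrite !ffunE linearP. Qed.

HB.instance Definition _ (T : {linear {mpoly R[n]} -> {mpoly R[n]}}) :=
  GRing.isLinear.Build R (clpoly R n) (clpoly R n) *:%R (lift T) (lift_linear T).

End Tensor.

Section Umbral.
Variables (R : realType) (n : nat).
Local Notation Rx := {mpoly R[n]}.
Local Notation P := (clpoly R n).
Implicit Types O X : 'I_n -> {linear Rx -> Rx}.

Definition translate (y : 'I_n -> R) (f : Rx) : Rx :=
  f \mPo [tuple 'X_i + (y i)%:MP | i < n].

Definition shift_invariant (T : Rx -> Rx) : Prop :=
  forall y f, T (translate y f) = translate y (T f).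

Definition delta_operator O : Prop :=
  (forall j, shift_invariant (O j)) /\
  exists2 c : R, c != 0 & forall j k, O j 'X_k = (c *+ (j == k))%:MP.

Definition commutator (a b : Rx -> Rx) (f : Rx) : Rx := a (b f) - b (a f).

Definition weyl_heisenberg O X : Prop :=
  forall j k f, [/\ commutator (O j) (O k) f = 0,
    commutator (X j) (X k) f = 0 & commutator (O j) (X k) f = f *+ (j == k)].

Definition umbral_dirac O (f : P) : P := \sum_j cl_e _ j * lift (O j) f.

Definition umbral_vector X (f : P) : P := \sum_j cl_e _ j * lift (X j) f.

Definition umbral_euler O X (f : P) : P := \sum_j lift (X j) (lift (O j) f).

Definition umbral_U O X (j : nat) (f : P) : P :=
  if odd j then umbral_euler O X f + (n%:R / 2 + j./2%:R : R) *: f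
  else (j./2%:R : R) *: f.

Definition umbral_ker O : set P := [set f | umbral_dirac O f = 0]%classic.

Lemma umbral_dirac_linear O : linear (umbral_dirac O).
Proof.
move=> c f g; rewrite scaler_sumr -big_split; apply: eq_bigr => j _.
by rewrite linearP mulrDr scalerAr.
Qed.

HB.instance Definition _ O :=
  GRing.isLinear.Build R P P *:%R (umbral_dirac O) (umbral_dirac_linear O).

HB.instance Definition _ X :=
  GRing.isLinear.Build R P P *:%R (umbral_vector X) (umbral_dirac_linear X).

Lemma umbral_euler_linear O X : linear (umbral_euler O X).
Proof.
move=> c f g; rewrite scaler_sumr -big_split; apply: eq_bigr => j _.
by rewrite !linearP.
Qed.

HB.instance Definition _ O X :=
  GRing.isLinear.Build R P P *:%R (umbral_euler O X) (umbral_euler_linear O X).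

End Umbral.

(* Main.v *)
Require Import Defs.
From HB Require Import structures.
From mathcomp Require Import classical_sets reals.
From mathcomp Require Import all_boot all_order all_algebra.
From mathcomp Require Import mpoly.

Import Order.TTheory GRing.Theory Num.Theory.
Local Open Scope ring_scope.
Local Open Scope classical_set_scope.

(** The operators [D = umbral_dirac O], [x = umbral_vector X] and
    [E = umbral_euler O X] generate a copy of the Lie superalgebra osp(1|2):
    the Weyl--Heisenberg and Clifford relations give
    [D x + x D = - 2 E - n], [E x = x (E + 1)] and [D E = (E + 1) D]
    ([dirac_vector], [euler_vector], [dirac_euler]).

    The first two relations yield [D x^2 = x^2 D - 2 x], because the
    contributions [x (2 E + n)] and [- (2 E + n) x] differ only by [- 2 x].
    Hence moving [D] through an even power [x^(2 m)] costs [- 2 m x^(2 m - 1)],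
    and for an odd power one more use of the anticommutator produces the Euler
    operator; on [ker D] both cases read [D x^(j+1) = - 2 x^j U_(j+1)]
    ([lower_iter_raise]). The third relation shows that [E], hence every
    [U_j], preserves [ker D] ([ker_osp_U]), so the one-step formula can be
    iterated [k] times, each new factor [U_j] landing to the left of the
    previous ones. The mapping property follows because the vector to which
    [x^(s - k)] is applied is again in [ker D].

    Polynomials intervene only through the relations among the operators, so
    both halves of the argument are carried out for abstract linear operators
    on a module. *)

(** * From Weyl--Heisenberg and Clifford relations to osp(1|2) *)

Section WeylClifford.
Variables (R : nzRingType) (V : lmodType R) (n : nat).
Variables e O X : 'I_n -> {linear V -> V}.
Hypothesis e_sqr : forall j v, e j (e j v) = - v.
Hypothesis e_anticomm : forall j k v, j != k -> e j (e k v) = - e k (e j v).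
Hypothesis eO : forall j k v, O j (e k v) = e k (O j v).
Hypothesis eX : forall j k v, X j (e k v) = e k (X j v).
Hypothesis OO : forall j k v, O j (O k v) = O k (O j v).
Hypothesis XX : forall j k v, X j (X k v) = X k (X j v).
Hypothesis OX : forall j k v, O j (X k v) = X k (O j v) + v *+ (j == k).

Local Notation D v := (\sum_j e j (O j v)).
Local Notation x v := (\sum_j e j (X j v)).
Local Notation E v := (\sum_j X j (O j v)).

Lemma sum_pick_diag (F : 'I_n -> 'I_n -> V) :
  \sum_j \sum_k F j k *+ (j == k) = \sum_j F j j.
Proof.
apply: eq_bigr => j _; rewrite (bigD1 j) //= eqxx big1 ?addr0 // => k kj.
by rewrite eq_sym (negPf kj).
Qed.

(** Off the diagonal the Clifford generators anticommute and the terms cancel;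
    the diagonal gives [- 2 E], and each of the [n] canonical commutators
    contributes [e_j^2 = - 1]. *)
Lemma dirac_vector v : D (x v) + x (D v) = - (2 *: E v) - n%:R *: v.
Proof.
have -> : x (D v) = \sum_j \sum_k e k (e j (X k (O j v))).
  rewrite exchange_big; apply: eq_bigr => k _ /=.
  rewrite linear_sum linear_sum; apply: eq_bigr => j _.
  by rewrite eX.
have -> : D (x v) =
    \sum_j \sum_k (e j (e k (X k (O j v))) + (e j (e k v)) *+ (j == k)).
  apply: eq_bigr => j _; rewrite linear_sum linear_sum.
  by apply: eq_bigr => k _; rewrite eO OX !linearD !linearMn.
under eq_bigr do rewrite big_split.
rewrite big_split /= sum_pick_diag.
under [X in _ + X + _]eq_bigr do rewrite e_sqr.
rewrite sumr_const card_ord mulNrn -scaler_nat addrAC -big_split; congr (_ - _).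
rewrite scaler_sumr -sumrN; apply: eq_bigr => j _ /=.
rewrite -big_split (bigD1 j) //= !e_sqr big1 ?addr0 => [|k kj].
  by rewrite -opprD scaler_nat mulr2n.
by rewrite e_anticomm ?addNr // eq_sym.
Qed.

Lemma euler_vector v : E (x v) = x (E v) + x v.
Proof.
transitivity (\sum_j \sum_k
    (e k (X k (X j (O j v))) + e k (X j v) *+ (k == j))).
  apply: eq_bigr => j _; rewrite linear_sum linear_sum; apply: eq_bigr => k _.
  by rewrite eO eX OX !linearD !linearMn (XX j k) eq_sym.
rewrite exchange_big /=; under eq_bigr do rewrite big_split.
rewrite big_split /= sum_pick_diag; congr (_ + _).
by apply: eq_bigr => k _; rewrite !linear_sum.
Qed.

Lemma dirac_euler v : D (E v) = E (D v) + D v.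
Proof.
transitivity (\sum_k \sum_j
    (e k (X j (O j (O k v))) + e k (O j v) *+ (k == j))).
  apply: eq_bigr => k _; rewrite linear_sum linear_sum; apply: eq_bigr => j _.
  by rewrite OX (OO k j) linearD linearMn.
under eq_bigr do rewrite big_split.
rewrite big_split /= sum_pick_diag; congr (_ + _).
rewrite exchange_big; apply: eq_bigr => j _ /=.
by rewrite linear_sum linear_sum; apply: eq_bigr => k _; rewrite eO eX.
Qed.
End WeylClifford.

(** * Lowering iterated raising operators on the kernel *)

Section LoweringRaising.
Variables (R : numFieldType) (V : lmodType R) (c : R).
Variables D x E : {linear V -> V}.
Hypothesis Dx : forall v, D (x v) + x (D v) = - (2 *: E v) - c *: v.
Hypothesis Ex : forall v, E (x v) = x (E v) + x v.
Hypothesis DE : forall v, D (E v) = E (D v) + D v.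

Definition osp_U j v :=
  if odd j then E v + (c / 2 + j./2%:R) *: v else (j./2%:R : R) *: v.

(** The Euler terms of two successive uses of the anticommutator cancel up to
    the commutator [E x - x E = x]. *)
Lemma lower_raise2 v : D (x (x v)) = x (x (D v)) - 2 *: x v.
Proof.
have DxE w : D (x w) = - (2 *: E w) - c *: w - x (D w) by rewrite -Dx addrK.
rewrite (DxE (x v)) (DxE v) Ex scalerDr !(linearB x) (linearN x).
rewrite !(linearZ_LR x) !opprD !opprK.
by rewrite (addrAC (- _) (- _)) -opprD addrAC addKr.
Qed.

(** On [ker D] the anticommutator reduces to [- 2 (E + c / 2) = - 2 U_1]; the
    step from [j] to [j + 2] uses [lower_raise2], which raises the integer
    part [m] of [U_j] by one. *)
Lemma lower_iter_raise j v : D v = 0 ->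
  D (iter j.+1 x v) = (- 2) *: iter j x (osp_U j.+1 v).
Proof.
move=> Dv0; elim/ltn_ind: j => -[|[|j]] IH.
- have := Dx v; rewrite Dv0 linear0 addr0 /= => ->.
  rewrite /osp_U /= addr0 scalerDr scalerA !scaleNr mulNr scaleNr.
  by rewrite mulrC divfK // pnatr_eq0.
- by rewrite /= lower_raise2 Dv0 !linear0 add0r /osp_U /= scale1r scaleNr.
have iterxD i w w' : iter i x (w + w') = iter i x w + iter i x w'.
  by elim: i => //= i ->; rewrite linearD.
rewrite [LHS]lower_raise2 -iterS IH // !(linearZ_LR x) -!iterS.
rewrite -scaleNr -scalerDr -iterxD; congr (_ *: iter _ _ _).
rewrite /osp_U /= negbK -[(uphalf j).+1]addn1 natrD.
by case: (odd j); rewrite /= ?addrA [in RHS]scalerDl scale1r ?addrA.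
Qed.

(** By [DE], [D E v = (E + 1) D v], which vanishes on [ker D]; the other part
    of [U_j] is a scalar. *)
Lemma ker_osp_U j v : D v = 0 -> D (osp_U j v) = 0.
Proof.
move=> Dv0; rewrite /osp_U; case: (odd j).
  by rewrite linearD linearZ_LR DE Dv0 linear0 scaler0 !addr0.
by rewrite linearZ_LR Dv0 scaler0.
Qed.

Lemma ker_comp_osp_U r v : D v = 0 ->
  D ((\big[comp/id]_(j <- r) osp_U j) v) = 0.
Proof.
move=> Dv0; elim: r => [|j r IHr]; first by rewrite big_nil.
by rewrite big_cons; apply: ker_osp_U.
Qed.

(** After [k] steps the result is, up to a scalar, [x^(s - k) g] with
    [g = U_(s-k+1) ... U_s v] in [ker D]; applying [lower_iter_raise] to [g]
    puts [U_(s-k)] in front of the product. *)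
Lemma iter_lower_iter_raise k s v : (k <= s)%N -> D v = 0 ->
  iter k D (iter s x v) =
  (- 2) ^+ k *: iter (s - k) x
    ((\big[comp/id]_((s - k).+1 <= j < s.+1) osp_U j) v).
Proof.
move=> + Dv0; elim: k => [|k IHk] lt_ks.
  by rewrite subn0 big_geq // scale1r.
rewrite iterS IHk ?(ltnW lt_ks) // linearZ_LR.
rewrite -[(s - k)%N](subnSK lt_ks) lower_iter_raise; last first.
  exact: ker_comp_osp_U.
rewrite scalerA -exprSr [in RHS]big_ltn //.
by rewrite ltnS (subnSK lt_ks) leq_subr.
Qed.

Lemma iter_lower_image k s : (k <= s)%N ->
  iter k D @` (iter s x @` [set v | D v = 0])
  `<=` iter (s - k) x @` [set v | D v = 0].
Proof.
move=> le_ks _ [_ [v Dv0 <-] <-]; rewrite iter_lower_iter_raise //.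
set g := (\big[comp/id]_(_ <= j < _) _) v.
exists ((- 2) ^+ k *: g).
  by rewrite /= linearZ_LR ker_comp_osp_U // scaler0.
by elim: (s - k)%N => //= i ->; rewrite linearZ_LR.
Qed.
End LoweringRaising.

(** * The operators on Clifford-valued polynomials *)

Lemma cl_e_sqr (A : comNzRingType) n (j : 'I_n) : cl_e A j * cl_e A j = -1.
Proof.
rewrite cl_basisM swaps1 leqnn expr1 mulN1r; congr (- _).
by apply/ffunP => S; rewrite !ffunE; congr ((_ == _)%:R);
  apply/setP => i; rewrite !inE addbb.
Qed.

Section CliffordLeft.
Variables (R : realType) (n : nat).

(** Named so that the product by [e_j] can carry the structure of a linear
    operator on which the abstract relations are instantiated. *)
Definition cl_left (j : 'I_n) (f : clpoly R n) : clpoly R n := cl_e _ j * f.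

Lemma cl_left_linear j : linear (cl_left j).
Proof. by move=> c f g; rewrite /cl_left mulrDr scalerAr. Qed.

HB.instance Definition _ j :=
  GRing.isLinear.Build R (clpoly R n) (clpoly R n) *:%R (cl_left j)
    (cl_left_linear j).

Lemma cl_left_sqr j f : cl_left j (cl_left j f) = - f.
Proof. by rewrite /cl_left mulrA cl_e_sqr mulN1r. Qed.

Lemma cl_left_anticomm j k f :
  j != k -> cl_left j (cl_left k f) = - cl_left k (cl_left j f).
Proof.
move=> /negPf jk; apply/eqP; rewrite -addr_eq0 /cl_left !mulrA -mulrDl cl_eC jk.
by rewrite mulr0n oppr0 mul0r.
Qed.

(** An operator on the coefficients commutes with left multiplication by a
    generator because the coordinates of [cl_e j] are the constants 0 and 1. *)
Lemma lift_cl_left (T : {linear {mpoly R[n]} -> {mpoly R[n]}}) j f :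
  Defs.lift T (cl_left j f) = cl_left j (Defs.lift T f).
Proof.
apply/ffunP => S; rewrite ffunE !clM_E linear_sum; apply: eq_bigr => U _.
rewrite !ffunE -signr_odd; case: (odd _); case: (U == _);
  by rewrite ?expr0 ?expr1 ?mulN1r ?mul1r ?mul0r ?oppr0 ?linearN ?linear0.
Qed.
End CliffordLeft.

Section UmbralOperators.
Variables (R : realType) (n : nat).
Variables O X : 'I_n -> {linear {mpoly R[n]} -> {mpoly R[n]}}.
Hypothesis OX_weyl : weyl_heisenberg O X.

Lemma lift_OO j k f :
  Defs.lift (O j) (Defs.lift (O k) f) = Defs.lift (O k) (Defs.lift (O j) f).
Proof.
apply/ffunP => S; rewrite !ffunE; apply/eqP; rewrite -subr_eq0; apply/eqP.
by case: (OX_weyl j k (f S)).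
Qed.

Lemma lift_XX j k f :
  Defs.lift (X j) (Defs.lift (X k) f) = Defs.lift (X k) (Defs.lift (X j) f).
Proof.
apply/ffunP => S; rewrite !ffunE; apply/eqP; rewrite -subr_eq0; apply/eqP.
by case: (OX_weyl j k (f S)).
Qed.

Lemma lift_OX j k f :
  Defs.lift (O j) (Defs.lift (X k) f) =
  Defs.lift (X k) (Defs.lift (O j) f) + f *+ (j == k).
Proof.
apply/ffunP => S; rewrite !ffunE.
case: (OX_weyl j k (f S)) => _ _ /eqP; rewrite subr_eq addrC => /eqP ->.
by case: (j == k); rewrite ?mulr1n ?mulr0n // ffunE.
Qed.

Let e (j : 'I_n) : {linear clpoly R n -> clpoly R n} := cl_left R n j.
Let LO (j : 'I_n) : {linear clpoly R n -> clpoly R n} := Defs.lift (O j).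
Let LX (j : 'I_n) : {linear clpoly R n -> clpoly R n} := Defs.lift (X j).

Lemma umbral_dirac_vector f :
  umbral_dirac O (umbral_vector X f) + umbral_vector X (umbral_dirac O f) =
  - (2 *: umbral_euler O X f) - n%:R *: f.
Proof.
exact: (@dirac_vector _ _ _ e LO LX (@cl_left_sqr R n) (@cl_left_anticomm R n)
  (fun j k => lift_cl_left R n (O j) k) (fun j k => lift_cl_left R n (X j) k) lift_OX).
Qed.

Lemma umbral_euler_vector f :
  umbral_euler O X (umbral_vector X f) =
  umbral_vector X (umbral_euler O X f) + umbral_vector X f.
Proof.
exact: (@euler_vector _ _ _ e LO LX
  (fun j k => lift_cl_left R n (O j) k) (fun j k => lift_cl_left R n (X j) k)
  lift_XX lift_OX).
Qed.

Lemma umbral_dirac_euler f :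
  umbral_dirac O (umbral_euler O X f) =
  umbral_euler O X (umbral_dirac O f) + umbral_dirac O f.
Proof.
exact: (@dirac_euler _ _ _ e LO LX
  (fun j k => lift_cl_left R n (O j) k) (fun j k => lift_cl_left R n (X j) k)
  lift_OO lift_OX).
Qed.
End UmbralOperators.

Theorem proposition3p1 (R : realType) (n : nat) (n_gt0 : (0 < n)%N)
    (O X : 'I_n -> {linear {mpoly R[n]} -> {mpoly R[n]}})
    (O_delta : delta_operator O) (OX_weyl : weyl_heisenberg O X)
    (k s : nat) (k_gt0 : (0 < k)%N) (le_ks : (k <= s)%N) :
  (iter k (umbral_dirac O) @` (iter s (umbral_vector X) @` umbral_ker O)
     `<=` iter (s - k) (umbral_vector X) @` umbral_ker O) /\
  (forall f : clpoly R n, umbral_ker O f ->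
     iter k (umbral_dirac O) (iter s (umbral_vector X) f) =
     (- 2 : R) ^+ k *: iter (s - k) (umbral_vector X)
       ((\big[comp/id]_((s - k).+1 <= j < s.+1) umbral_U O X j) f)).
Proof.
pose D : {linear clpoly R n -> clpoly R n} := umbral_dirac O.
pose x : {linear clpoly R n -> clpoly R n} := umbral_vector X.
pose E : {linear clpoly R n -> clpoly R n} := umbral_euler O X.
have Dx := umbral_dirac_vector R n O X OX_weyl.
have Ex := umbral_euler_vector R n O X OX_weyl.
have DE := umbral_dirac_euler R n O X OX_weyl.
split; first exact: (@iter_lower_image _ _ n%:R D x E Dx Ex DE).
by move=> f Df0; exact: (@iter_lower_iter_raise _ _ n%:R D x E Dx Ex DE).
Qed.
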